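(* Let $k$ be a field, and suppose we are given an action of a $k$-vector-space $A$ on a pair $(M_0,M_1)$ of $k$-vector-spaces and an action of a $k$-vector-space $B$ on a pair $(N_0,N_1)$ of $k$-vector-spaces. If each of these actions is faithful, then so is the induced action of the $k$-vector-space $A\otimes_k B$ on the pair $(M_0\otimes_k N_0,\,M_1\otimes_k N_1)$.
   Context: For a commutative ring $k$ and $k$-modules $A$, $M_0$, $M_1$, an action of $A$ on $(M_0,M_1)$ means a $k$-linear map $A\to\mathrm{Hom}_k(M_0,M_1)$, written $(a,u)\mapsto au$ ($a\in A$, $u\in M_0$, $au\in M_1$). The action is faithful if the map $A\to\mathrm{Hom}_k(M_0,M_1)$ is one-to-one. Given an action of $A$ on $(M_0,M_1)$ and an action of a $k$-module $B$ on $(N_0,N_1)$, the induced action of $A\otimes_k B$ on $(M_0\otimes_k N_0,\,M_1\otimes_k N_1)$ is the one in which an element $\sum_{1\le i\le n}a_i\otimes b_i$ ($a_i\in A$, $b_i\in B$) sends $u\otimes v$ ($u\in M_0$, $v\in N_0$) to $\sum_i a_iu\otimes b_iv\in M_1\otimes_k N_1$, extended $k$-linearly to all of $M_0\otimes_k N_0$. No algebra structure on $A$ or $B$ is assumed. *)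

(* Defs.v *)
From HB Require Import structures.
From mathcomp Require Import all_boot all_order all_algebra.
From mathcomp Require Import finmap boolp monalg.

Set Implicit Arguments.
Unset Strict Implicit.
Unset Printing Implicit Defensive.

Import GRing.Theory Quotient.

Local Open Scope ring_scope.
Local Open Scope quotient_scope.

Section Hom.
Variables (k : comNzRingType) (U V : lmodType k).
Implicit Types f g h : {linear U -> V}.

(* Pointwise module structure; the classical mixins are only there because
   modules carry decidable equality and choice. *)
HB.instance Definition _ := gen_eqMixin {linear U -> V}.
HB.instance Definition _ := gen_choiceMixin {linear U -> V}.

Lemma hom_ext f g : f =1 g -> f = g.
Proof.
move=> fg; have e : (f : U -> V) = g by apply/funext.
case: f g e {fg} => [f cf] [g cg] /= e.
by case: _ / e cg => cg; congr GRing.Linear.Pack; case: cf cg => [[?] [?]] [[?] [?]];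
  congr GRing.Linear.Class; congr (_ _); apply: Prop_irrelevance.
Qed.

Definition hom_zero : {linear U -> V} := \0.
Definition hom_opp f : {linear U -> V} := \- f.
Definition hom_add f g : {linear U -> V} := f \+ g.
Definition hom_scale (a : k) f : {linear U -> V} := a \*: f.

Fact hom_addA : associative hom_add.
Proof. by move=> f g h; apply: hom_ext => x /=; rewrite addrA. Qed.
Fact hom_addC : commutative hom_add.
Proof. by move=> f g; apply: hom_ext => x /=; rewrite addrC. Qed.
Fact hom_add0 : left_id hom_zero hom_add.
Proof. by move=> f; apply: hom_ext => x /=; rewrite add0r. Qed.
Fact hom_addN : left_inverse hom_zero hom_opp hom_add.
Proof. by move=> f; apply: hom_ext => x /=; rewrite addNr. Qed.

HB.instance Definition _ :=
  GRing.isZmodule.Build {linear U -> V} hom_addA hom_addC hom_add0 hom_addN.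

Fact hom_scaleA a b f : hom_scale a (hom_scale b f) = hom_scale (a * b) f.
Proof. by apply: hom_ext => x /=; rewrite scalerA. Qed.
Fact hom_scale1 : left_id 1 hom_scale.
Proof. by move=> f; apply: hom_ext => x /=; rewrite scale1r. Qed.
Fact hom_scaleDr : right_distributive hom_scale +%R.
Proof. by move=> a f g; apply: hom_ext => x /=; rewrite scalerDr. Qed.
Fact hom_scaleDl f : {morph hom_scale^~ f : a b / a + b}.
Proof. by move=> a b; apply: hom_ext => x /=; rewrite scalerDl. Qed.

HB.instance Definition _ := GRing.Zmodule_isLmodule.Build k {linear U -> V}
  hom_scaleA hom_scale1 hom_scaleDr hom_scaleDl.

Lemma hom_addE f g x : (f + g) x = f x + g x. Proof. by []. Qed.
Lemma hom_scaleE a f x : (a *: f) x = a *: f x. Proof. by []. Qed.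

End Hom.

Section Tensor.
Variables (k : comNzRingType) (U V : lmodType k).

Local Notation free := {malg k[(U * V)%type]}.
Local Notation gen u v := (<< (1 : k) *g (u, v) >> : free).

(* The submodule of the free module on U * V generated by the bilinearity
   relations; the last two constructors close it under linear combinations. *)
Inductive tensor_rel : free -> Prop :=
| tensor_relDl u u' v : tensor_rel (gen (u + u') v - (gen u v + gen u' v))
| tensor_relDr u v v' : tensor_rel (gen u (v + v') - (gen u v + gen u v'))
| tensor_relZl a u v : tensor_rel (gen (a *: u) v - a *: gen u v)
| tensor_relZr a u v : tensor_rel (gen u (a *: v) - a *: gen u v)
| tensor_rel0 : tensor_rel 0
| tensor_relP a x y : tensor_rel x -> tensor_rel y -> tensor_rel (a *: x + y).

Definition tensor_relb : {pred free} := fun x => `[< tensor_rel x >].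

Lemma tensor_relbP x : reflect (tensor_rel x) (x \in tensor_relb).
Proof. exact: asboolP. Qed.

Fact tensor_relb_submod : submod_closed tensor_relb.
Proof.
split; first exact/tensor_relbP/tensor_rel0.
by move=> a x y /tensor_relbP hx /tensor_relbP hy; apply/tensor_relbP/tensor_relP.
Qed.

HB.instance Definition _ :=
  GRing.isSubmodClosed.Build k free tensor_relb tensor_relb_submod.

Definition tensor : Type := {quot tensor_relb}.

HB.instance Definition _ := GRing.Zmodule.on tensor.

Local Notation cls := (\pi_{quot tensor_relb} : free -> tensor).

Lemma tensor_clsE (x y : free) : tensor_rel (x - y) <-> cls x = cls y.
Proof.
split=> [h|/eqmodP h]; last exact/tensor_relbP.
by apply/eqmodP/tensor_relbP.
Qed.

Lemma tensor_clsD (x y : free) : cls (x + y) = cls x + cls y.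
Proof. exact: (raddfD (\pi_{quot tensor_relb})). Qed.

Definition tensor_scale (a : k) (t : tensor) : tensor := cls (a *: repr t).

Lemma tensor_clsZ a (x : free) : cls (a *: x) = tensor_scale a (cls x).
Proof.
apply/tensor_clsE; rewrite -scalerBr -[_ *: _]addr0.
apply: tensor_relP tensor_rel0; apply/tensor_clsE.
by rewrite [RHS]reprK.
Qed.

Lemma tensor_clsP (t : tensor) : exists x, t = cls x.
Proof. by exists (repr t); rewrite [RHS]reprK. Qed.

Fact tensor_scaleA a b t :
  tensor_scale a (tensor_scale b t) = tensor_scale (a * b) t.
Proof. by have [x ->] := tensor_clsP t; rewrite -!tensor_clsZ scalerA. Qed.
Fact tensor_scale1 : left_id 1 tensor_scale.
Proof. by move=> t; have [x ->] := tensor_clsP t; rewrite -tensor_clsZ scale1r. Qed.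
Fact tensor_scaleDr : right_distributive tensor_scale +%R.
Proof.
move=> a s t; have [x ->] := tensor_clsP s; have [y ->] := tensor_clsP t.
by rewrite -tensor_clsD -!tensor_clsZ -tensor_clsD scalerDr.
Qed.
Fact tensor_scaleDl t : {morph tensor_scale^~ t : a b / a + b}.
Proof.
move=> a b; have [x ->] := tensor_clsP t.
by rewrite -!tensor_clsZ -tensor_clsD scalerDl.
Qed.

HB.instance Definition _ := GRing.Zmodule_isLmodule.Build k tensor
  tensor_scaleA tensor_scale1 tensor_scaleDr tensor_scaleDl.

Definition tens (u : U) (v : V) : tensor := cls (gen u v).

Fact tens_bilinear :
  bilinear_for (GRing.Scale.Law.clone _ _ *:%R _)
               (GRing.Scale.Law.clone _ _ *:%R _) tens.
Proof.
split=> [v|u] a x y; rewrite /tens.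
- have /tensor_clsE -> := tensor_relDl (a *: x) y v.
  by rewrite tensor_clsD; have /tensor_clsE -> := tensor_relZl a x v;
    rewrite tensor_clsZ.
- have /tensor_clsE -> := tensor_relDr u (a *: x) y.
  by rewrite tensor_clsD; have /tensor_clsE -> := tensor_relZr a u x;
    rewrite tensor_clsZ.
Qed.

HB.instance Definition _ := bilinear_isBilinear.Build k U V tensor _ _ tens
  tens_bilinear.

Section Lift.
Variables (W : lmodType k) (f : {bilinear U -> V -> W}).

(* [free_lift] is the linear extension of (u, v) |-> f u v to the free module;
   it kills [tensor_rel], which gives the universal property. *)
Definition free_lift (x : free) : W :=
  \sum_(p <- msupp x) x@_p *: f p.1 p.2.

Lemma free_liftEw (D : {fset (U * V)%type}) (x : free) :
  (msupp x `<=` D)%fset -> free_lift x = \sum_(p <- D) x@_p *: f p.1 p.2.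
Proof.
move=> sD; rewrite /free_lift; apply: big_fset_incl => // p _ /mcoeff_outdom ->.
by rewrite scale0r.
Qed.

Fact free_lift_linear : linear free_lift.
Proof.
move=> a x y; pose D := (msupp x `|` msupp y `|` msupp (a *: x + y))%fset.
rewrite !(@free_liftEw D) ?fsubsetUr //; first last.
- by rewrite /D -fsetUA fsubsetUl.
- by rewrite /D fsubsetU // fsubsetUr.
rewrite scaler_sumr -big_split /=; apply: eq_bigr => p _.
by rewrite mcoeffD [(a *: x)@_p]fgscaleE scalerDl scalerA.
Qed.

HB.instance Definition _ :=
  GRing.isLinear.Build k free W *:%R free_lift free_lift_linear.

Lemma free_liftU u v : free_lift (gen u v) = f u v.
Proof.
rewrite (@free_liftEw [fset (u, v)]%fset) ?msuppU_le //.
by rewrite big_seq_fset1 mcoeffUU scale1r.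
Qed.

Lemma free_lift_rel x : tensor_rel x -> free_lift x = 0.
Proof.
elim=> [u u' v|u v v'|a u v|a u v||a y z _ y0 _ z0].
- by rewrite linearB linearD /= !free_liftU linearDl subrr.
- by rewrite linearB linearD /= !free_liftU linearDr subrr.
- by rewrite linearB linearZ /= !free_liftU linearZl_LR subrr.
- by rewrite linearB linearZ /= !free_liftU linearZr_LR subrr.
- exact: linear0.
- by rewrite linearP /= y0 z0 scaler0 addr0.
Qed.

Definition tensor_lift_fun (t : tensor) : W := free_lift (repr t).

Lemma tensor_lift_cls x : tensor_lift_fun (cls x) = free_lift x.
Proof.
apply/eqP; rewrite -subr_eq0 -linearB; apply/eqP/free_lift_rel.
by apply/tensor_clsE; rewrite [LHS]reprK.
Qed.

Fact tensor_lift_linear : linear tensor_lift_fun.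
Proof.
move=> a s t; have [x ->] := tensor_clsP s; have [y ->] := tensor_clsP t.
rewrite -[a *: _]tensor_clsZ -tensor_clsD !tensor_lift_cls.
exact: linearP.
Qed.

HB.instance Definition _ :=
  GRing.isLinear.Build k tensor W *:%R tensor_lift_fun tensor_lift_linear.

Definition tensor_lift : {linear tensor -> W} := tensor_lift_fun.

Lemma tensor_liftE u v : tensor_lift (tens u v) = f u v.
Proof. by rewrite /tensor_lift /= tensor_lift_cls free_liftU. Qed.

End Lift.

Lemma tensorE (t : tensor) : exists s : seq (U * V), t = \sum_(p <- s) tens p.1 p.2.
Proof.
have [x ->] := tensor_clsP t; exists [seq (x@_p *: p.1, p.2) | p <- msupp x].
rewrite {1}[x]monalgE big_map.
rewrite (big_morph cls tensor_clsD (raddf0 (\pi_{quot tensor_relb}))).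
apply: eq_bigr => -[u v] _ /=; rewrite linearZl_LR /=.
rewrite -[RHS]tensor_clsZ; congr cls; apply/malgP => q.
by rewrite [RHS]fgscaleE !mcoeffU mulrnAr mulr1.
Qed.

Lemma tensor_lift_unique (W : lmodType k) (g h : {linear tensor -> W}) :
  (forall u v, g (tens u v) = h (tens u v)) -> g = h.
Proof.
move=> gh; apply: hom_ext => t; have [s ->] := tensorE t.
by rewrite !linear_sum; apply: eq_bigr => p _; apply: gh.
Qed.

End Tensor.

Notation "U ⊗ V" := (tensor U V) (at level 40, left associativity) : type_scope.
Notation "u ⊗ v" := (tens u v) (at level 40, left associativity) : ring_scope.

Section TensorMap.
Variables (k : comNzRingType) (U V U' V' : lmodType k).

Section Fun.
Variables (f : {linear U -> U'}) (g : {linear V -> V'}).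

Definition tensor_map_fun (u : U) (v : V) : (U' ⊗ V')%type := f u ⊗ g v.

Fact tensor_map_bilinear :
  bilinear_for (GRing.Scale.Law.clone _ _ *:%R _)
               (GRing.Scale.Law.clone _ _ *:%R _) tensor_map_fun.
Proof.
split=> [v|u] a x y; rewrite /tensor_map_fun linearP.
- by rewrite linearPl.
- by rewrite linearPr.
Qed.

HB.instance Definition _ := bilinear_isBilinear.Build k U V (U' ⊗ V')%type _ _
  tensor_map_fun tensor_map_bilinear.

Definition tensor_map : {linear (U ⊗ V)%type -> (U' ⊗ V')%type} :=
  tensor_lift tensor_map_fun.

Lemma tensor_mapE u v : tensor_map (u ⊗ v) = f u ⊗ g v.
Proof. exact: tensor_liftE. Qed.

End Fun.

End TensorMap.

(* [act a u] is the element written au in M1. *)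
Definition action (k : comNzRingType) (A M0 M1 : lmodType k) : Type :=
  {linear A -> {linear M0 -> M1}}.

Definition faithful (k : comNzRingType) (A M0 M1 : lmodType k)
    (act : action A M0 M1) : Prop :=
  injective (act : A -> {linear M0 -> M1}).

Section TensorAction.
Variables (k : comNzRingType) (A M0 M1 B N0 N1 : lmodType k).
Variables (actA : action A M0 M1) (actB : action B N0 N1).

Definition tensor_action_fun (a : A) (b : B) :
  {linear (M0 ⊗ N0)%type -> (M1 ⊗ N1)%type} := tensor_map (actA a) (actB b).

Fact tensor_action_bilinear :
  bilinear_for (GRing.Scale.Law.clone _ _ *:%R _)
               (GRing.Scale.Law.clone _ _ *:%R _) tensor_action_fun.
Proof.
split=> [b|a] c x y; apply: tensor_lift_unique => u v;
  rewrite hom_addE hom_scaleE !tensor_mapE linearP hom_addE hom_scaleE.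
- by rewrite linearPl.
- by rewrite linearPr.
Qed.

HB.instance Definition _ := bilinear_isBilinear.Build k A B
  {linear (M0 ⊗ N0)%type -> (M1 ⊗ N1)%type} _ _
  tensor_action_fun tensor_action_bilinear.

Definition tensor_action : action (A ⊗ B)%type (M0 ⊗ N0)%type (M1 ⊗ N1)%type :=
  tensor_lift tensor_action_fun.

Lemma tensor_actionE (s : seq (A * B)) (u : M0) (v : N0) :
  tensor_action (\sum_(p <- s) p.1 ⊗ p.2) (u ⊗ v)
  = \sum_(p <- s) actA p.1 u ⊗ actB p.2 v.
Proof.
rewrite linear_sum (big_morph (fun h : {linear _ -> _} => h (u ⊗ v))
  (fun f g => hom_addE f g _) (erefl _)).
by apply: eq_bigr => p _; rewrite tensor_liftE tensor_mapE.
Qed.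

End TensorAction.

(* Main.v *)
Require Import Defs.
From mathcomp Require Import all_boot all_order all_algebra.
From HB Require Import structures.
From mathcomp Require Import boolp classical_sets.

(** Work with a representative [sum_i a_i ⊗ b_i] whose action vanishes, that
    is, with [sum_i (a_i u) ⊗ (b_i v) = 0] for all [u] and [v].

    The field hypothesis enters through one principle
    ([bilinear_sum_eq0]): if [sum_i phi(x_i) y_i = 0] for every linear form
    [phi], then [sum_i x_i ⊗ y_i = 0].  Stating it for an arbitrary bilinear map
    in place of [⊗] lets the two factors be exchanged, so that linear forms may be
    moved from one factor to the other.

    Given a linear form [phi] on [M1], contracting the hypothesis with [phi]
    shows that [sum_i phi(a_i u) b_i] kills every [v], hence is zero because [B]
    acts faithfully.  This holds for all [phi], so [sum_i (a_i u) ⊗ b_i = 0] in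
    [M1 ⊗ B].  Contracting now with a linear form [psi] on [B] shows that
    [sum_i psi(b_i) a_i] kills every [u], hence is zero because [A] acts
    faithfully; and since [psi] is arbitrary, [sum_i a_i ⊗ b_i = 0].

    The principle itself is proved by shortening the sum: either [x_0] lies in
    the span of the other [x_i] and its term can be absorbed, or some linear form
    is [1] at [x_0] and [0] at the others, which forces [y_0 = 0].  In infinite
    dimension, such a form comes from Zorn's lemma ([separating_form]). *)

Set Implicit Arguments.
Unset Strict Implicit.
Unset Printing Implicit Defensive.

Import GRing.Theory.

Local Open Scope ring_scope.
Local Open Scope classical_set_scope.

(** * Linear forms separating a vector from a subspace *)

Section SeparatingForm.
Variables (k : fieldType) (U : lmodType k).
Implicit Types (S H : set U) (e x : U).

Definition subspace S : Prop :=
  S 0 /\ forall (a : k) x y, S x -> S y -> S (a *: x + y).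

Lemma subspaceZ S a x : subspace S -> S x -> S (a *: x).
Proof. by move=> [S0 SP] Sx; rewrite -[_ *: _]addr0; apply: SP. Qed.

Lemma subspaceB S x y : subspace S -> S x -> S y -> S (x - y).
Proof. by move=> [_ SP] Sx Sy; rewrite addrC -scaleN1r; apply: SP. Qed.

(** A subspace maximal among those that contain [S] and avoid [e] is a
    complement of the line through [e]: for [x] outside of [H], the span of [H]
    and [x] contains [e], by maximality, and solving for [x] gives the claim. *)
Lemma exists_complement S e : subspace S -> ~ S e ->
  exists H, [/\ subspace H, S `<=` H, ~ H e &
                forall x, exists c : k, H (x - c *: e)].
Proof.
move=> subS Se.
(* Adjoining [S] by a union makes the empty set admissible: it is the union of
   the empty chain. *)
pose P A := subspace (A `|` S) /\ ~ (A `|` S) e.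
have chainP F : F `<=` P -> total_on F subset -> P (\bigcup_(A in F) A).
  move=> FP Ftot; split; last first.
    by move=> [[A FA Ae]|//]; have [_] := FP _ FA; apply; left.
  split=> [|a x y]; first by right; case: subS.
  have lift A z : F A -> (A `|` S) z -> (\bigcup_(A in F) A `|` S) z.
    by move=> FA [Az|]; [left; exists A|right].
  move=> [[A FA Ax]|Sx] [[B FB By]|Sy]; last by right; case: subS => _; apply.
  - have [AB|BA] := Ftot _ _ FA FB.
      by apply: (lift B) => //; have [[_ BP] _] := FP _ FB;
        apply: BP; left => //; apply: AB.
    by apply: (lift A) => //; have [[_ AP] _] := FP _ FA;
      apply: AP; left => //; apply: BA.
  - by apply: (lift A) => //; have [[_ AP] _] := FP _ FA; apply: AP; [left|right].
  - by apply: (lift B) => //; have [[_ BP] _] := FP _ FB; apply: BP; [right|left].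
have [A [[subH He] maxA]] := Zorn_bigcup chainP.
move: subH He; set H := A `|` S => subH He.
have SH : S `<=` H by move=> x; right.
exists H; split=> // x.
have [Hx|Hx] := pselect (H x); first by exists 0; rewrite scale0r subr0.
pose B : set U := [set y | exists c : k, H (y - c *: x)].
have HB : H `<=` B by move=> y Hy; exists 0; rewrite scale0r subr0.
have subB : subspace B.
  split=> [|a y z [c Hy] [d Hz]]; first by apply: HB; case: subH.
  exists (a * c + d); have := subH.2 a _ _ Hy Hz.
  by rewrite scalerBr addrACA -opprD scalerDl scalerA.
have BS : B `|` S = B.
  by apply/seteqP; split=> [y [//|/SH/HB]|y] //; left.
have [c Hec] : B e.
  apply: contrapT => Be; apply: (maxA B); last by rewrite /P BS.
  split=> [y Ay|BA]; first by apply: HB; left.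
  apply: Hx; left; apply: BA; exists 1.
  by rewrite scale1r subrr; case: subH.
have c0 : c != 0.
  by apply/eqP => c0; apply: He; move: Hec; rewrite c0 scale0r subr0.
exists c^-1; have := subspaceZ (- c^-1) subH Hec.
by rewrite scalerBr scalerA mulNr mulVf // !scaleNr scale1r opprK addrC.
Qed.

(** The form is the coordinate along [e] modulo a complement of its line. *)
Lemma separating_form S e : subspace S -> ~ S e ->
  exists phi : {scalar U}, phi e = 1 /\ forall x, S x -> phi x = 0.
Proof.
move=> subS Se; have [H [subH SH He coord]] := exists_complement subS Se.
have [f fP] := choice coord.
have f_unique x c : H (x - c *: e) -> f x = c.
  move=> Hc; apply: contrapT => /eqP; rewrite -subr_eq0 => fc; apply: He.
  have := subspaceZ (f x - c)^-1 subH (subspaceB subH Hc (fP x)).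
  by rewrite opprB [X in _ *: X]addrC addrA subrK -scalerBl scalerA mulVf ?scale1r.
have f_linear : linear_for *%R f.
  move=> a x y; apply: f_unique; have := subH.2 a _ _ (fP x) (fP y).
  by rewrite scalerBr addrACA -opprD scalerDl scalerA.
pose F := GRing.isLinear.Build k U k *%R f f_linear.
pose phi : {scalar U} := HB.pack f F.
exists phi; split=> [|x /SH Hx] /=; apply: f_unique.
- by rewrite scale1r subrr; case: subH.
- by rewrite scale0r subr0.
Qed.

Definition span n (x : 'I_n -> U) : set U :=
  [set z | exists c : 'I_n -> k, z = \sum_(i < n) c i *: x i].

Lemma subspace_span n (x : 'I_n -> U) : subspace (span x).
Proof.
split=> [|a _ _ [c ->] [d ->]].
  by exists (fun=> 0); rewrite big1 // => i _; rewrite scale0r.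
exists (fun i => a * c i + d i); rewrite scaler_sumr -big_split /=.
by apply: eq_bigr => i _; rewrite scalerDl scalerA.
Qed.

Lemma mem_span n (x : 'I_n -> U) i : span x (x i).
Proof.
exists (fun j => (j == i)%:R); rewrite (bigD1 i) //= eqxx scale1r.
by rewrite big1 ?addr0 // => j /negPf->; rewrite scale0r.
Qed.

End SeparatingForm.

(** * Linear forms detect the vanishing of a sum of tensors *)

(** Over a field, [phi ⊗ id], with [phi] ranging over linear forms, jointly
    detect zero on [X ⊗ Y]; every bilinear map factors through [X ⊗ Y].
    Taking for [f] a bilinear map with its arguments exchanged gives the mirror
    statement, where the linear forms are on the second factor. *)
Lemma bilinear_sum_eq0 (k : fieldType) (X Y W : lmodType k)
    (f : {bilinear X -> Y -> W}) n (x : 'I_n -> X) (y : 'I_n -> Y) :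
  (forall phi : {scalar X}, \sum_(i < n) phi (x i) *: y i = 0) ->
  \sum_(i < n) f (x i) (y i) = 0.
Proof.
elim: n x y => [|n IHn] x y xy0; first by rewrite big_ord0.
pose x' i := x (lift ord0 i); pose y' i := y (lift ord0 i).
rewrite big_ord_recl /=.
have [[c x0E]|x0_notin] := pselect (span x' (x ord0)).
  (* Here [x_0 = sum_i c_i x_i], and the term of [y_0] is absorbed by adding
     [c_i y_0] to each [y_i]. *)
- have x'y0 (phi : {scalar X}) :
      \sum_(i < n) phi (x' i) *: (c i *: y ord0 + y' i) = 0.
    rewrite -[RHS](xy0 phi) big_ord_recl x0E linear_sum scaler_suml.
    rewrite -big_split /=; apply: eq_bigr => i _.
    by rewrite linearZ /= scalerDr !scalerA mulrC.
  rewrite x0E linear_sumlz -big_split /= -[RHS](IHn _ _ x'y0).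
  by apply: eq_bigr => i _; rewrite linearPr linearZl_LR.
- have [phi [phi_x0 phi_x']] := separating_form (subspace_span x') x0_notin.
  have y0 : y ord0 = 0.
    rewrite -[RHS](xy0 phi) big_ord_recl phi_x0 scale1r big1 ?addr0 // => i _.
    by rewrite phi_x' ?scale0r //; apply: mem_span.
  rewrite y0 linear0r add0r; apply: (IHn x' y') => psi.
  by rewrite -[RHS](xy0 psi) big_ord_recl y0 scaler0 add0r.
Qed.

(** * Contraction of a tensor along a linear form *)

Section Bilinear.
Variables (k : comNzRingType) (X Y W : lmodType k).

Definition flip (f : {bilinear X -> Y -> W}) (y : Y) (x : X) : W := f x y.

Fact flip_bilinear f :
  bilinear_for (GRing.Scale.Law.clone _ _ *:%R _)
               (GRing.Scale.Law.clone _ _ *:%R _) (flip f).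
Proof. by split=> u a v w; rewrite /flip ?linearPl ?linearPr. Qed.

HB.instance Definition _ f := bilinear_isBilinear.Build k Y X W _ _
  (flip f) (flip_bilinear f).

Definition contract (phi : {scalar X}) (x : X) (y : Y) : Y := phi x *: y.

Fact contract_bilinear phi :
  bilinear_for (GRing.Scale.Law.clone _ _ *:%R _)
               (GRing.Scale.Law.clone _ _ *:%R _) (contract phi).
Proof.
split=> [y|x] a u v; rewrite /contract.
- by rewrite linearP /= scalerDl scalerA.
- by rewrite scalerDr /= !scalerA mulrC.
Qed.

HB.instance Definition _ phi := bilinear_isBilinear.Build k X Y Y _ _
  (contract phi) (contract_bilinear phi).

End Bilinear.

Lemma tensor_sum_contract (k : comNzRingType) (X Y : lmodType k) n
    (x : 'I_n -> X) (y : 'I_n -> Y) (phi : {scalar X}) :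
  \sum_(i < n) x i ⊗ y i = 0 -> \sum_(i < n) phi (x i) *: y i = 0.
Proof.
move=> xy0; have := linear0 (tensor_lift (contract (Y := Y) phi)).
by rewrite -xy0 linear_sum; under eq_bigr do rewrite tensor_liftE.
Qed.

Lemma hom_sumE (k : comNzRingType) (U V : lmodType k) n
    (h : 'I_n -> {linear U -> V}) u : (\sum_(i < n) h i) u = \sum_(i < n) h i u.
Proof.
exact: (big_morph (fun g : {linear U -> V} => g u)
  (fun f g => hom_addE f g u) (erefl _)).
Qed.

(** * Faithful actions *)

Lemma faithful_comb_eq0 (k : comNzRingType) (A M0 M1 : lmodType k)
    (act : action A M0 M1) n (c : 'I_n -> k) (a : 'I_n -> A) :
  faithful act -> (forall u, \sum_(i < n) c i *: act (a i) u = 0) ->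
  \sum_(i < n) c i *: a i = 0.
Proof.
move=> act_inj act0; apply: act_inj; rewrite linear0 linear_sum.
apply: hom_ext => u; rewrite hom_sumE -[RHS](act0 u).
by apply: eq_bigr => i _; rewrite linearZ.
Qed.

Theorem theorem5 (k : fieldType) (A M0 M1 B N0 N1 : lmodType k)
    (actA : action A M0 M1) (actB : action B N0 N1) :
  faithful actA -> faithful actB -> faithful (tensor_action actA actB).
Proof.
move=> injA injB; apply: raddf_inj => t t0.
have [s tE] := tensorE t.
pose a (i : 'I_(size s)) := (tnth (in_tuple s) i).1.
pose b (i : 'I_(size s)) := (tnth (in_tuple s) i).2.
have ab0 u v : \sum_i actA (a i) u ⊗ actB (b i) v = 0.
  have := tensor_actionE actA actB s u v; rewrite -tE t0 => /esym.
  by rewrite big_tnth.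
have phi_b0 u (phi : {scalar M1}) : \sum_i phi (actA (a i) u) *: b i = 0.
  apply: (faithful_comb_eq0 injB) => v.
  exact: (tensor_sum_contract phi (ab0 u v)).
have psi_a0 (psi : {scalar B}) : \sum_i psi (b i) *: a i = 0.
  apply: (faithful_comb_eq0 injA) => u.
  exact: (bilinear_sum_eq0 (flip (contract (Y := M1) psi)) (phi_b0 u)).
rewrite tE big_tnth.
exact: (bilinear_sum_eq0 (flip (@tens k A B)) psi_a0).
Qed.
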